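(* Let $n$ and $k$ be integers with $2\le k\le n-1$. If a vertex $\mathbf a=a_1a_2\cdots a_n$ of $G(n)$ is contained in some closed $k$-walk in $G(n)$, then \[\mathrm{st}(a_1a_2\cdots a_{n-k})=\mathrm{st}(a_{k+1}a_{k+2}\cdots a_n).\]
   Context: For a sequence of distinct integers $c_1\cdots c_t$, its standardization $\mathrm{st}(c_1\cdots c_t)$ is the unique permutation $b_1\cdots b_t$ of $\{1,\dots,t\}$ with $b_i<b_j$ if and only if $c_i<c_j$. Permutations are written in one-line notation. The graph of overlapping permutations $G(n)$ is the directed multigraph whose vertices are the permutations of $\{1,\dots,n\}$ and whose edges are the permutations $c_1\cdots c_{n+1}$ of $\{1,\dots,n+1\}$; the edge $c_1\cdots c_{n+1}$ goes from $\mathrm{st}(c_1\cdots c_n)$ to $\mathrm{st}(c_2\cdots c_{n+1})$. Thus there is an edge from $a_1\cdots a_n$ to $b_1\cdots b_n$ iff $\mathrm{st}(a_2\cdots a_n)=\mathrm{st}(b_1\cdots b_{n-1})$, and there may be several edges from one vertex to another. A closed $k$-walk is a sequence $(v_1,e_1,v_2,e_2,\dots,v_k,e_k,v_1)$ where $e_i$ is an edge from $v_i$ to $v_{i+1}$ (indices mod $k$), usually written $(v_1,\dots,v_k)$; a vertex is contained in it if it is one of the $v_i$. *)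

(* Defs.v *)
From mathcomp Require Import all_boot all_order all_fingroup all_algebra.

Set Implicit Arguments.
Unset Strict Implicit.
Unset Printing Implicit Defensive.

Import Order.TTheory GRing.Theory Num.Theory.

(* A permutation of {1, ..., t} is represented by an element of 'S_t, which
   acts on {0, ..., t - 1}; [oneline] shifts its values back to 1, ..., t.
   Positions in tuples are counted from 0. *)
Definition oneline t (a : 'S_t) : t.-tuple int := [tuple Posz (a i).+1 | i < t].

(* [factor i m a] is a_{i+1} ... a_{i+m}. It is meant for i + m <= t only:
   entries past the end of the word are read as 0. *)
Definition factor t (i m : nat) (a : 'S_t) : m.-tuple int :=
  [tuple nth 0%R (oneline a) (i + j) | j < m].

Definition order_iso t (c : t.-tuple int) (b : 'S_t) : bool :=
  [forall i, forall j, (b i < b j)%N == (tnth c i < tnth c j)%R].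

(* The default value 1 is only reached when the entries of c are not distinct:
   see [st_order_iso] and [st_unique]. *)
Definition st t (c : t.-tuple int) : 'S_t :=
  odflt 1%g [pick b : 'S_t | order_iso c b].

Record multigraph := Multigraph {
  vertex : Type;
  edge : Type;
  source : edge -> vertex;
  target : edge -> vertex }.

(* The closed walk (v_1, e_1, ..., v_k, e_k, v_1); [ordS] is the cyclic
   successor on 'I_k. *)
Definition closed_walk (G : multigraph) k
    (v : 'I_k -> vertex G) (e : 'I_k -> edge G) : Prop :=
  forall i, source (e i) = v i /\ target (e i) = v (ordS i).

Definition in_closed_walk (G : multigraph) k (x : vertex G) : Prop :=
  exists (v : 'I_k -> vertex G) (e : 'I_k -> edge G),
    closed_walk v e /\ exists i, v i = x.

Definition overlap_graph n : multigraph :=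
  {| vertex := 'S_n;
     edge := 'S_n.+1;
     source := fun c => st (factor 0 n c);
     target := fun c => st (factor 1 n c) |}.

Lemma order_iso_exists t (c : t.-tuple int) :
  uniq c -> exists b : 'S_t, order_iso c b.
Proof.
move=> /tuple_uniqP c_inj.
pose below i := [set j | (tnth c j < tnth c i)%R].
have below_lt i j : (tnth c i < tnth c j)%R -> #|below i| < #|below j|.
  move=> cij; apply/proper_card/properP; split.
    by apply/subsetP=> l; rewrite !inE => /lt_trans; apply.
  by exists i; rewrite !inE ?ltxx.
have rank_lt i : #|below i| < t.
  rewrite -[t in _ < t]card_ord -cardsT; apply/proper_card/properP.
  by split; [exact: subsetT | exists i; rewrite !inE ?ltxx].
have rank_inj : injective (fun i => Ordinal (rank_lt i)).
  move=> i j [] eq_ij; apply: c_inj.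
  by case: (ltgtP (tnth c i) (tnth c j)) => // /below_lt; rewrite eq_ij ltnn.
exists (perm rank_inj); apply/'forall_forallP => i j; rewrite !permE /=.
case: (ltgtP (tnth c i) (tnth c j)) => [/below_lt -> // | | /c_inj ->].
  by move=> /below_lt/ltnW; rewrite ltnNge => ->.
by rewrite ltnn.
Qed.

Lemma st_order_iso t (c : t.-tuple int) : uniq c -> order_iso c (st c).
Proof.
by rewrite /st => /order_iso_exists[b cb]; case: pickP => //= /(_ b); rewrite cb.
Qed.

Lemma st_unique t (c : t.-tuple int) (b : 'S_t) : order_iso c b -> st c = b.
Proof.
move=> cb.
have rankE (s : 'S_t) i : #|[set j | s j < s i]| = s i.
  rewrite -(card_imset _ (@perm_inj _ s)).
  have -> : s @: [set j | s j < s i] = [set x : 'I_t | x < s i].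
    apply/setP=> x; apply/imsetP/idP => [[j] | ]; rewrite !inE.
      by move=> sij ->.
    by move=> ltx; exists ((s^-1)%g x); rewrite ?inE permKV.
  rewrite cardsE cardE size_filter.
  rewrite -(count_map val (fun x => x < s i)) -enumT val_enum_ord.
  rewrite -size_filter (@filter_iota_ltn 0 t (s i)) ?size_iota //.
  exact: ltnW (ltn_ord _).
have cst : order_iso c (st c) by rewrite /st; case: pickP => // /(_ b); rewrite cb.
apply/permP=> i; apply/val_inj; rewrite /= -rankE -[RHS]rankE.
apply: eq_card => j; rewrite !inE.
by rewrite (eqP (forallP (forallP cst j) i)) (eqP (forallP (forallP cb j) i)).
Qed.

Lemma factor_uniq t i m (a : 'S_t) : i + m <= t -> uniq (factor i m a).
Proof.
move=> le_im; have lt_t (j : 'I_m) : i + j < t.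
  by apply: leq_trans le_im; rewrite ltn_add2l.
apply/tuple_uniqP => j l; rewrite !tnth_mktuple.
rewrite -[i + j]/(val (Ordinal (lt_t j))) -[i + l]/(val (Ordinal (lt_t l))).
rewrite -!tnth_nth !tnth_mktuple => -[] /val_inj/perm_inj[] /addnI.
exact: val_inj.
Qed.

(* Main.v *)
Require Import Defs.
From mathcomp Require Import all_boot all_order all_fingroup all_algebra.

(** An edge from u to v makes u_2 ... u_n and v_1 ... v_{n-1} order isomorphic,
    so after j steps from u to v the words u_{j+1} ... u_n and v_1 ... v_{n-j}
    are order isomorphic. A closed k-walk through a gives this with
    u = v = a and j = k. *)

Set Implicit Arguments.
Unset Strict Implicit.
Unset Printing Implicit Defensive.

(** Positions are naturals, not ordinals, so that shifting them between words needs no casts. Past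
    the end an entry reads as 0, hence the bounds assumed below. *)
Definition word_lt t (a : 'S_t) (p q : nat) : bool :=
  (nth 0 (oneline a) p < nth 0 (oneline a) q)%R.

Lemma word_ltE t (a : 'S_t) (x y : 'I_t) : word_lt a x y = (a x < a y)%N.
Proof. by rewrite /word_lt -!tnth_nth !tnth_mktuple. Qed.

Lemma st_factor_lt t i m (a : 'S_t) (x y : 'I_m) : i + m <= t ->
  (st (factor i m a) x < st (factor i m a) y)%N = word_lt a (i + x) (i + y).
Proof.
move=> le_im; have /forallP/(_ x)/forallP/(_ y)/eqP -> :=
  st_order_iso (factor_uniq a le_im).
by rewrite !tnth_mktuple.
Qed.

Lemma word_lt_st_factor t i m (a : 'S_t) p q : i + m <= t -> p < m -> q < m ->
  word_lt (st (factor i m a)) p q = word_lt a (i + p) (i + q).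
Proof.
move=> le_im ltp ltq.
by rewrite (word_ltE _ (Ordinal ltp) (Ordinal ltq)) st_factor_lt.
Qed.

(** Both sides compare the letters of [c] itself at positions [p.+1] and [q.+1]. *)
Lemma word_lt_edge n (c : edge (overlap_graph n)) p q : p.+1 < n -> q.+1 < n ->
  word_lt (source c) p.+1 q.+1 = word_lt (target c) p q.
Proof.
by move=> ltp ltq; rewrite !word_lt_st_factor ?add0n ?add1n // ltnW.
Qed.

Lemma word_lt_walk n k (v : 'I_k -> vertex (overlap_graph n))
    (e : 'I_k -> edge (overlap_graph n)) i j p q :
  closed_walk v e -> j + p < n -> j + q < n ->
  word_lt (v i) (j + p) (j + q) = word_lt (v (iter j (@ordS k) i)) p q.
Proof.
(* The first edge is peeled off, so the starting index [i] must stay general. *)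
move=> walk; elim: j i => [//|j IHj] i; rewrite !addSn => ltp ltq.
have [<- tgt] := walk i.
by rewrite word_lt_edge // tgt IHj ?iterSr // ltnW.
Qed.

Lemma iter_ordS k (i : 'I_k) : iter k (@ordS k) i = i.
Proof.
have valE j : val (iter j (@ordS k) i) = (i + j) %% k.
  elim: j => [|j IHj] /=; first by rewrite addn0 modn_small.
  by rewrite IHj -addn1 modnDml addn1 addnS.
by apply: val_inj; rewrite valE modnDr modn_small.
Qed.

Theorem theorem3p1 (n k : nat) (a : 'S_n) :
  2 <= k <= n - 1 ->
  in_closed_walk (G := overlap_graph n) k a ->
  st (factor 0 (n - k) a) = st (factor k (n - k) a).
Proof.
move=> /andP[_ le_kn1] [v [e [walk [i <-]]]].
have le_kn : k <= n := leq_trans le_kn1 (leq_subr 1 n).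
(* By uniqueness of standardization, it suffices that the right-hand permutation is ordered like the
   first [n - k] letters. *)
apply: st_unique; apply/forallP => x; apply/forallP => y; apply/eqP.
have lt_n (z : 'I_(n - k)) : k + z < n by rewrite -ltn_subRL.
rewrite st_factor_lt ?subnKC // (word_lt_walk _ walk) // iter_ordS.
by rewrite !tnth_mktuple !add0n.
Qed.
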